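(* Let $f(\mathbf{x}):=e^{\mathbf{1}^\top\mathbf{x}}-1$ on $\mathbb{R}^d$. (a) Let $k>0$ be fixed, and for $u>0$ let $\mathbf{v}_0:=ku\mathbf{1}\in\mathbb{R}^d_{>0}$ and $J:=\operatorname{conv}\{\mathbf{v}_0,\mathbf{v}_0-u\mathbf{e}_1,\dots,\mathbf{v}_0-u\mathbf{e}_d\}$. Then $$\lim_{u\to\infty}u^d\cdot\frac{\operatorname{vol}(P^0(f,J))-\operatorname{vol}(P(f,J))}{\operatorname{vol}(P^0(f,J))}=(d+1)!.$$ (b) Let $\mathbf{v}_0\in\mathbb{R}^d_{\ge0}\setminus\{\mathbf{0}\}$ be fixed and for $u>0$ let $J:=\operatorname{conv}\{\mathbf{v}_0,\mathbf{v}_0+u\mathbf{e}_1,\dots,\mathbf{v}_0+u\mathbf{e}_d\}$. Then $$\lim_{u\to\infty}u\cdot\frac{\operatorname{vol}(P^0(f,J))-\operatorname{vol}(P(f,J))}{\operatorname{vol}(P^0(f,J))}=d+1.$$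
   Context: $\mathbf{e}_j$ is the $j$-th unit vector and $\mathbf{1}$ the all-ones vector in $\mathbb{R}^d$. Let $\mu$ be the unique affine function agreeing with $f$ at the vertices of $J$ and $\mu(\mathbf{x},z):=z\mu(\mathbf{x}/z)$ (extended linearly in $(\mathbf{x},z)$). For $z\ge0$, $z\cdot J:=\{z\mathbf{x}:\mathbf{x}\in J\}$. Perspective relaxation: $P(f,J):=\operatorname{cl}\{(\mathbf{x},y,z)\in\mathbb{R}^d\times\mathbb{R}\times\mathbb{R}:\mu(\mathbf{x},z)\ge y\ge zf(\mathbf{x}/z),\ \mathbf{x}\in z\cdot J,\ 1\ge z>0\}$. Naive relaxation: $P^0(f,J):=\{(\mathbf{x},y,z)\in\mathbb{R}^d\times\mathbb{R}\times\mathbb{R}:\mu(\mathbf{x},z)\ge y\ge f(\mathbf{x}),\ \mathbf{x}\in z\cdot J,\ 1\ge z\ge0\}$. $\operatorname{vol}$ is $(d+2)$-dimensional Lebesgue measure. *)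

(* Defs.v *)
From HB Require Import structures.
From mathcomp Require Import all_boot all_order all_algebra.
From mathcomp Require Import all_classical all_reals all_analysis.
Set Implicit Arguments. Unset Strict Implicit. Unset Printing Implicit Defensive.
Import Order.TTheory GRing.Theory Num.Theory.
Import numFieldNormedType.Exports.
Local Open Scope classical_set_scope.
Local Open Scope ring_scope.

Section Defs.
Variable R : realType.

Definition dotv (d : nat) (a x : 'rV[R]_d) : R := \sum_(j < d) a 0 j * x 0 j.

Definition fexp (d : nat) (x : 'rV[R]_d) : R := expR (\sum_(j < d) x 0 j) - 1.

Definition unitv (d : nat) (j : 'I_d) : 'rV[R]_d := \row_(i < d) (i == j)%:R.
Definition onesv (d : nat) : 'rV[R]_d := \row_(i < d) 1.

Definition conv (d n : nat) (w : 'I_n -> 'rV[R]_d) : set 'rV[R]_d :=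
  [set x | exists lam : 'I_n -> R,
     (forall i, 0 <= lam i) /\ \sum_(i < n) lam i = 1 /\ x = \sum_(i < n) lam i *: w i].

Definition scale_set (d : nat) (z : R) (J : set 'rV[R]_d) : set 'rV[R]_d :=
  [set z *: x | x in J].

(* the affine function x |-> a.x + b agreeing with g at the vertices w i of the
   simplex J = conv w, encoded by its coefficients (a, b) *)
Definition affine_interp (d : nat) (w : 'I_d.+1 -> 'rV[R]_d) (g : 'rV[R]_d -> R)
  : 'rV[R]_d * R :=
  xget (0, 0) [set ab | forall i, dotv ab.1 (w i) + ab.2 = g (w i)].

(* the homogenization mu(x, z) := z mu(x / z) = a.x + z b *)
Definition mu_hom (d : nat) (ab : 'rV[R]_d * R) (x : 'rV[R]_d) (z : R) : R :=
  dotv ab.1 x + z * ab.2.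

Definition persp_relax (d : nat) (g : 'rV[R]_d -> R) (w : 'I_d.+1 -> 'rV[R]_d)
  : set ('rV[R]_d * R * R) :=
  closure [set p | let x := p.1.1 in let y := p.1.2 in let z := p.2 in
    y <= mu_hom (affine_interp w g) x z /\ z * g (z^-1 *: x) <= y /\
    scale_set z (conv w) x /\ 0 < z /\ z <= 1].

Definition naive_relax (d : nat) (g : 'rV[R]_d -> R) (w : 'I_d.+1 -> 'rV[R]_d)
  : set ('rV[R]_d * R * R) :=
  [set p | let x := p.1.1 in let y := p.1.2 in let z := p.2 in
    y <= mu_hom (affine_interp w g) x z /\ g x <= y /\
    scale_set z (conv w) x /\ 0 <= z /\ z <= 1].

Fixpoint iint (n : nat) (h : (nat -> R) -> \bar R) (x : nat -> R) : \bar R :=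
  match n with
  | 0 => h x
  | n'.+1 => (\int[@lebesgue_measure R]_t
                iint n' h (fun i => if i == n' then t else x i))%E
  end.

(* (d+2)-dimensional Lebesgue volume of S subset R^d x R x R
   (computed as an iterated integral of the indicator, = product Lebesgue
   measure for Borel sets by Tonelli) *)
Definition vol (d : nat) (S : set ('rV[R]_d * R * R)) : \bar R :=
  iint d.+2 (fun x => ((\1_S ((\row_(j < d) x j, x d), x d.+1)) : R)%:E)
       (fun _ => 0).

Definition vol_gap (d : nat) (w : 'I_d.+1 -> 'rV[R]_d) : R :=
  let V0 := fine (vol (naive_relax (@fexp d) w)) in
  let V := fine (vol (persp_relax (@fexp d) w)) in
  (V0 - V) / V0.

Definition verts_a (d : nat) (k u : R) : 'I_d.+1 -> 'rV[R]_d :=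
  fun i => match unlift ord0 i with
           | None => (k * u) *: onesv d
           | Some j => (k * u) *: onesv d - u *: unitv j
           end.

Definition verts_b (d : nat) (v0 : 'rV[R]_d) (u : R) : 'I_d.+1 -> 'rV[R]_d :=
  fun i => match unlift ord0 i with
           | None => v0
           | Some j => v0 + u *: unitv j
           end.

End Defs.

(* Main.v *)
(* Write the simplices of (a) and (b) as v + s * t with t in u times the standard
   simplex and s = -1 or s = 1. On such a simplex both f and its affine interpolant
   depend on x only through r = sum t_j, and the level sets of r have volume
   r^(d-1)/(d-1)!. Since the closure in P only adds points with z = 0, Tonelli reduces
   both volumes to integrals over 0 <= r <= z u, 0 <= z <= 1. With c = 1^T v,
     A = int_0^u e^(s r) r^(d-1)/(d-1)! dr,
     N = int_0^1 int_0^(z u) e^(z c + s r) r^(d-1)/(d-1)! dr dz,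
     B = u^d/(d+1)! (f(v) + d f(v + s u e_1)),
   one gets
     vol P  = (B + u^d/d! - e^c A) / (d+2),
     vol P0 = B/(d+2) + u^d/(d+1)! - N.
   The term N is negligible: N <= e^c/c in (a), N <= u^(d-1)/(d-1)! e^(c+u)/(c+u) in (b).
   Finally A -> 1 in (a) and A ~ e^u u^(d-1)/(d-1)! in (b), which gives both limits. *)
Require Import Defs.
From HB Require Import structures.
From mathcomp Require Import all_boot all_order all_algebra.
From mathcomp Require Import all_classical all_reals all_analysis.
From mathcomp Require Import measurable_realfun ring lra.
Import Order.TTheory GRing.Theory Num.Theory.
Import numFieldNormedType.Exports.
Local Open Scope classical_set_scope.
Local Open Scope ring_scope.

Set Implicit Arguments.
Unset Strict Implicit.
Unset Printing Implicit Defensive.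

(** * Translations and reflections of the real line *)

(** As [s] is 1 or -1, the preimage of an interval []x, y]] is an interval of the same length, and
    Lebesgue measure is determined by its values on half-open intervals. For [s = -1] the closed end
    of the preimage is the left one. *)
Lemma lebesgue_measure_isometry (R : realType) (s a : R) (A : set R) :
  s ^+ 2 = 1 -> measurable A ->
  pushforward (@lebesgue_measure R)
    ((fun t => s * (t - a)) : _ -> measurableTypeR R) A = @lebesgue_measure R A.
Proof.
move=> s2 mA.
have mphi : measurable_fun [set: R] (fun t : R => s * (t - a)).
  by apply: measurable_funM => //; exact: measurable_funB.
apply/esym/lebesgue_measure_unique => //= _ [[x y]] _ <-.
have [->|->] : s = 1 \/ s = -1.
  by move/eqP : s2; rewrite sqrf_eq1 => /orP[/eqP|/eqP]; [left|right].
- rewrite /pushforward/= [X in _ = _ X](_ : _ = `]x + a, y + a]%classic).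
    rewrite !lebesgue_measure_itv/= !lte_fin ltrD2r; case: ifP => // _.
    by rewrite -!EFinB; congr (_%:E); ring.
  apply/seteqP; split => t /=; rewrite !in_itv/= => /andP[? ?]; apply/andP; split; lra.
- rewrite /pushforward/= [X in _ = _ X](_ : _ = `[a - y, a - x[%classic).
    rewrite !lebesgue_measure_itv/= !lte_fin ltrD2l ltrN2; case: ifP => // _.
    by rewrite -!EFinB; congr (_%:E); ring.
  apply/seteqP; split => t /=; rewrite !in_itv/= => /andP[? ?]; apply/andP; split; lra.
Qed.

Lemma ge0_integral_isometry (R : realType) (s a : R) (f : R -> \bar R) :
  s ^+ 2 = 1 -> measurable_fun [set: R] f -> (forall t, 0 <= f t)%E ->
  (\int[@lebesgue_measure R]_t f (s * (t - a))%R
   = \int[@lebesgue_measure R]_t f t)%E.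
Proof.
move=> s2 mf f0.
have mphi : measurable_fun [set: R] (fun t : R => s * (t - a)).
  by apply: measurable_funM => //; exact: measurable_funB.
transitivity (\int[pushforward (@lebesgue_measure R)
    ((fun t => s * (t - a))%R : _ -> measurableTypeR R)]_t f t)%E.
  by rewrite ge0_integral_pushforward.
by apply: eq_measure_integral => A mA _; exact: lebesgue_measure_isometry.
Qed.

(** * Monomial densities and the fundamental theorem of calculus *)

(** Density of the coordinate sum on the nonnegative orthant of dimension [n.+1]. Dividing by the
    factorial makes each of these functions the derivative of the next. *)
Definition monomial_density {R : realType} (n : nat) (r : R) : R := r ^+ n / n`!%:R.

Lemma monomial_density_ge0 (R : realType) n (r : R) :
  0 <= r -> 0 <= monomial_density n r.
Proof. by move=> r0; rewrite /monomial_density divr_ge0// exprn_ge0. Qed.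

Lemma measurable_monomial_density (R : realType) n :
  measurable_fun [set: R] (@monomial_density R n).
Proof. by apply: measurable_funM => //; exact: measurable_funX. Qed.

Lemma is_derive_monomial_density (R : realType) n (x : R) :
  is_derive x 1 (@monomial_density R n.+1) (monomial_density n x).
Proof.
rewrite /monomial_density.
suff -> : x ^+ n / n`!%:R = (n.+1`!%:R^-1 : R) *: (n.+1%:R * x ^+ n *: 1).
  rewrite (_ : (fun r : R => _) = (n.+1`!%:R^-1 : R) \*: (id ^+ n.+1 : R -> R)).
    by apply: is_deriveZ; exact: is_deriveX.
  by apply/funext => r /=; rewrite exprfctE mulrC.
rewrite /GRing.scale/= factS natrM; field.
by rewrite nat1r !pnatr_eq0 -!lt0n fact_gt0.
Qed.

Lemma integral_itv_antiderivative (R : realType) (f F : R -> R) (a b : R) :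
  a <= b -> continuous f -> (forall x : R, is_derive x 1 F (f x)) ->
  (\int[@lebesgue_measure R]_(x in `[a, b]) (f x)%:E = (F b - F a)%:E)%E.
Proof.
rewrite le_eqVlt => /orP[/eqP <- _ _|ab cf dF].
  by rewrite subrr set_itv1 integral_set1.
have cF : continuous F.
  by move=> x; apply: differentiable_continuous; apply/derivable1_diffP; by case: (dF x).
rewrite (@continuous_FTC2 _ f F)//.
- exact: continuous_subspaceT.
- split; first by move=> x _; case: (dF x).
    exact/cvg_at_right_filter/cF.
  exact/cvg_at_left_filter/cF.
- by move=> x _; rewrite derive1E; case: (dF x).
Qed.

Lemma continuous_monomial_density (R : realType) n :
  continuous (@monomial_density R n).
Proof.
move=> r; apply: differentiable_continuous; apply/derivable1_diffP.
case: n => [|n]; last by case: (is_derive_monomial_density n r).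
by rewrite /monomial_density; under eq_fun do rewrite expr0; exact: derivable_cst.
Qed.

Lemma integral_monomial_density (R : realType) n (x : R) : 0 <= x ->
  (\int[@lebesgue_measure R]_(r in `[0%R, x]) (monomial_density n r)%:E
   = (monomial_density n.+1 x)%:E)%E.
Proof.
move=> x0; rewrite (integral_itv_antiderivative x0 (@continuous_monomial_density _ n)
  (is_derive_monomial_density n)).
by rewrite {2}/monomial_density expr0n mul0r subr0.
Qed.

(** * Iterated integrals over an orthant *)

(** The iterated integral overwrites only the coordinates below [n], so the integrand is evaluated
    only at points that agree with [x] from index [n] on. *)
Lemma eq_iint (R : realType) n (h h' : (nat -> R) -> \bar R) (x : nat -> R) :
  (forall y, (forall i, (n <= i)%N -> y i = x i) -> h y = h' y) ->
  iint n h x = iint n h' x.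
Proof.
elim: n x => [|n IH] x hh'; first exact: hh'.
apply: eq_integral => t _; apply: IH => y yx; apply: hh' => i ni.
by rewrite yx ?(ltnW ni)// gtn_eqF.
Qed.

Lemma iint0 (R : realType) n (x : nat -> R) : iint n (fun=> 0%E) x = 0%E.
Proof. by elim: n x => [//|n IH] x /=; under eq_integral do rewrite IH; rewrite integral0. Qed.

(* A simplex in R^(n+1) is sliced along the level sets of the coordinate sum,
   whose volume is [r ^ n / n!]. *)
Lemma iint_orthant_sum (R : realType) (s : R) (a : nat -> R) (n : nat)
    (phi : R -> \bar R) (x : nat -> R) :
  s ^+ 2 = 1 -> measurable_fun [set: R] phi -> (forall r, 0 <= phi r)%E ->
  iint n.+1 (fun y => if [forall i : 'I_n.+1, 0 <= s * (y i - a i)]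
                      then phi (\sum_(i < n.+1) s * (y i - a i)) else 0%E) x
  = (\int[@lebesgue_measure R]_r
       (if (0 <= r)%R then phi r * (monomial_density n r)%:E else 0))%E.
Proof.
move=> s2; elim: n phi x => [|n IH] phi x mphi phi0.
  rewrite -(@ge0_integral_isometry _ s (a 0%N))//.
  - apply: eq_integral => t _ /=.
    rewrite (_ : [forall i : 'I_1, _] = (0 <= s * (t - a 0%N))); last first.
      apply/forallP/idP => [/(_ ord0)//|t0 i]; by rewrite ord1.
    by rewrite big_ord1/= /monomial_density expr0 fact0 divr1 mule1.
  - apply: measurable_fun_ifT => //; first exact: measurable_fun_ler.
    by apply: emeasurable_funM => //; apply/measurable_EFinP; exact: measurable_monomial_density.
  - move=> t; case: ifP => // t0; apply: mule_ge0 => //.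
    by rewrite lee_fin monomial_density_ge0.
(* The first argument is the shifted outermost coordinate, the second the sum of the others, to
   which the induction hypothesis assigns the density [monomial_density n]. *)
pose g (p : R * R) : \bar R := if (0 <= p.1) && (0 <= p.2)
  then (phi (p.1 + p.2)%R * (monomial_density n p.2)%:E)%E else 0%E.
have mg : measurable_fun [set: (measurableTypeR R * measurableTypeR R)%type] g.
  apply: measurable_fun_ifT => //.
    by apply: measurable_and; apply: measurable_fun_ler => //.
  apply: emeasurable_funM => //.
    by apply: (measurableT_comp mphi); exact: measurable_funD.
  by apply/measurable_EFinP; apply: (measurableT_comp (@measurable_monomial_density R n)).
have g0 p : (0 <= g p)%E.
  rewrite /g; case: ifP => // /andP[_ p0]; apply: mule_ge0 => //.
  by rewrite lee_fin monomial_density_ge0.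
transitivity (\int[@lebesgue_measure R]_t \int[@lebesgue_measure R]_r g (t, r))%E.
  pose G t : \bar R := (\int[@lebesgue_measure R]_r g (t, r))%E.
  have mG : measurable_fun [set: R] G.
    exact: (@measurable_fun_fubini_tonelli_F _ _ _ _ _ (@lebesgue_measure R) g mg g0).
  have G0 t : (0 <= G t)%E by apply: integral_ge0 => r _; exact: g0.
  rewrite -/G -(ge0_integral_isometry (a n.+1) s2 mG G0) /G.
  apply: eq_integral => t _; set tau := s * (t - a n.+1).
  transitivity (iint n.+1 (fun y => if 0 <= tau then
      if [forall i : 'I_n.+1, 0 <= s * (y i - a i)]
      then phi (tau + \sum_(i < n.+1) s * (y i - a i)) else 0%E else 0%E)
      (fun i => if i == n.+1 then t else x i)).
    apply: (@eq_iint _ n.+1) => y yE; rewrite big_ord_recr/= addrC yE// eqxx -/tau.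
    have [tau0|tau0] := boolP (0 <= tau).
      congr (if _ then _ else _); apply/forallP/forallP => [h i|h i].
        exact: (h (widen_ord (leqnSn _) i)).
      have [ni|ni] := ltnP i n.+1; first exact: (h (Ordinal ni)).
      have -> : i = ord_max by apply/val_inj/eqP; rewrite eqn_leq ni -ltnS ltn_ord.
      by rewrite /= yE// eqxx.
    case: ifP => // /forallP/(_ ord_max)/=.
    by rewrite yE// eqxx (negbTE tau0).
  have [tau0|/negbTE tau0] := boolP (0 <= tau).
    rewrite (IH (fun r => phi (tau + r)))//; last first.
      by apply: (measurableT_comp mphi); exact: measurable_funD.
    by apply: eq_integral => r _; rewrite /g/= tau0.
  by rewrite iint0 integral0_eq// => r _; rewrite /g/= tau0.
rewrite fubini_tonelli//.
(* With the total sum [q = t + r] in place of [t], the condition [0 <= t] becomes [r <= q]. For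
   fixed [q], integrating over [0 <= r <= q] raises the density from [n] to [n.+1]. *)
pose k (p : R * R) : \bar R := if (0 <= p.1) && (p.1 <= p.2)
  then (phi p.2 * (monomial_density n p.1)%:E)%E else 0%E.
have mk : measurable_fun [set: (measurableTypeR R * measurableTypeR R)%type] k.
  apply: measurable_fun_ifT => //.
    by apply: measurable_and; apply: measurable_fun_ler => //.
  apply: emeasurable_funM => //; first exact: (measurableT_comp mphi).
  by apply/measurable_EFinP; apply: (measurableT_comp (@measurable_monomial_density R n)).
have k0 p : (0 <= k p)%E.
  rewrite /k; case: ifP => // /andP[p0 _]; apply: mule_ge0 => //.
  by rewrite lee_fin monomial_density_ge0.
transitivity (\int[@lebesgue_measure R]_r \int[@lebesgue_measure R]_q k (r, q))%E.
  apply: eq_integral => r _.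
  have <- := @ge0_integral_isometry _ 1 (- r) (fun q => k (r, q)) (expr1n _ 2)
    (measurableT_comp mk (pair1_measurable r)) (fun q => k0 (r, q)).
  apply: eq_integral => t _; rewrite /g /k/= mul1r opprK lerDr andbC.
  by [].
rewrite fubini_tonelli//; apply: eq_integral => q _.
have [q0|q0] := leP 0 q; last first.
  apply: integral0_eq => r _; rewrite /k/=; case: ifP => // /andP[r0 rq].
  by have := le_trans r0 rq; rewrite leNgt q0.
rewrite -integral_monomial_density// -ge0_integralZl//; last 2 first.
  by apply/measurable_EFinP/measurable_funTS; exact: measurable_monomial_density.
  by move=> r/=; rewrite in_itv/= => /andP[r0 _]; rewrite lee_fin monomial_density_ge0.
rewrite [RHS]integral_mkcond; apply: eq_integral => r _.
by rewrite patchE mem_setE in_itv.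
Qed.

(** * The volume of a region from its slices *)

(** Nothing is asked of [F] at 0, where the closure in [persp_relax] may add points: a single point
    is a null set. *)
Lemma integral_setT_itv01 (R : realType) (F : R -> \bar R) (g : R -> R) :
  measurable_fun [set: R] g ->
  (forall z, 0 < z <= 1 -> F z = (g z)%:E) ->
  (forall z, z != 0 -> ~~ (0 < z <= 1) -> F z = 0%E) ->
  (\int[@lebesgue_measure R]_z F z
   = \int[@lebesgue_measure R]_(z in `[0%R, 1%R]) (g z)%:E)%E.
Proof.
move=> mg Fg F0.
pose G z := if (0 < z) && (z <= 1) then (g z)%:E else 0%E.
have mG : measurable_fun [set: R] G.
  apply: measurable_fun_ifT => //; last exact/measurable_EFinP.
  by apply: measurable_and; [exact: measurable_fun_ltr|exact: measurable_fun_ler].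
(* [F] can differ from the measurable [G] only at 0, hence is measurable whatever [F 0] is. *)
have FE : F = fun z => if z == 0 then F 0 else G z.
  apply/funext => z; case: eqP => [->//|/eqP z0]; rewrite /G.
  by case: ifPn => [/Fg//|/F0 ->].
have mF : measurable_fun [set: R] F.
  by rewrite FE; apply: measurable_fun_ifT => //; exact: measurable_fun_eqr.
rewrite -integral_itv_obnd_cbnd; last exact/measurable_EFinP/measurable_funTS.
rewrite [RHS]integral_mkcond; apply: ae_eq_integral => //.
  rewrite (_ : _ \_ _ = G)//; apply/funext => z.
  by rewrite patchE mem_setE in_itv.
exists [set 0%R]; split => //; first exact: lebesgue_measure_set1.
move=> z /=; apply: contra_notP => /eqP z0 _ /=; rewrite patchE mem_setE in_itv/=.
by rewrite FE (negbTE z0).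
Qed.

(** For fixed [z] and [y], [iint_orthant_sum] turns the integral over [x] into one over the
    coordinate sum [r]. Exchanging [y] and [r] makes the inner integral the height [up z r - lo z r]
    of the region above [r]. *)
Lemma vol_region (R : realType) (n : nat) (s u : R) (v : 'rV[R]_n.+1)
    (S : set ('rV[R]_n.+1 * R * R)) (lo up : R -> R -> R) (g : R -> R) :
  s ^+ 2 = 1 ->
  (forall z, measurable_fun [set: R] (lo z)) ->
  (forall z, measurable_fun [set: R] (up z)) ->
  (forall z r, 0 < z <= 1 -> 0 <= r <= z * u -> lo z r <= up z r) ->
  (forall x y z, z != 0 -> S ((x, y), z) <->
    [/\ 0 < z <= 1, forall i, 0 <= s * (x 0 i - z * v 0 i),
      \sum_i s * (x 0 i - z * v 0 i) <= z * u,
      lo z (\sum_i s * (x 0 i - z * v 0 i)) <= y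
      & y <= up z (\sum_i s * (x 0 i - z * v 0 i))]) ->
  measurable_fun [set: R] g ->
  (forall z, 0 < z <= 1 ->
    (\int[@lebesgue_measure R]_(r in `[0%R, (z * u)%R])
       ((up z r - lo z r) * monomial_density n r)%:E = (g z)%:E)%E) ->
  vol S = (\int[@lebesgue_measure R]_(z in `[0%R, 1%R]) (g z)%:E)%E.
Proof.
move=> s2 mlo mup loup SE mg gE; rewrite /vol; apply: integral_setT_itv01 => //; last first.
  move=> z z0 z01; apply: integral0_eq => y _.
  (* Coordinate [n.+1] carries [y] and [n.+2] carries [z], as in [vol] with [d = n.+1]; both stay
     fixed under the inner integrals. *)
  rewrite -[RHS](@iint0 R n.+1 (fun i => if i == n.+1 then y
    else if i == n.+2 then z else 0)).
  apply: (@eq_iint _ n.+1) => x xE; rewrite !xE//= eqxx gtn_eqF// eqxx indicE memNset//.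
  by rewrite SE// => -[]; rewrite (negbTE z01).
move=> z z01.
have z0 : z != 0 by rewrite gt_eqF//; case/andP: z01.
pose phi y r : \bar R :=
  if [&& r <= z * u, lo z r <= y & y <= up z r] then 1%E else 0%E.
pose k (p : R * R) : \bar R :=
  if 0 <= p.2 then (phi p.1 p.2 * (monomial_density n p.2)%:E)%E else 0%E.
have mk : measurable_fun [set: (measurableTypeR R * measurableTypeR R)%type] k.
  apply: measurable_fun_ifT => //; first exact: measurable_fun_ler.
  apply: emeasurable_funM => //; last first.
    by apply/measurable_EFinP; apply: (measurableT_comp (@measurable_monomial_density R n)).
  apply: measurable_fun_ifT => //; apply: measurable_and; last apply: measurable_and.
  - exact: measurable_fun_ler.
  - by apply: measurable_fun_ler => //; exact: (measurableT_comp (mlo z)).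
  - by apply: measurable_fun_ler => //; exact: (measurableT_comp (mup z)).
have phi0 y r : (0 <= phi y r)%E by rewrite /phi; case: ifP.
have k0 p : (0 <= k p)%E.
  rewrite /k; case: ifP => // p0; apply: mule_ge0 => //.
  by rewrite lee_fin monomial_density_ge0.
transitivity (\int[@lebesgue_measure R]_y \int[@lebesgue_measure R]_r k (y, r))%E.
  apply: eq_integral => y _.
  rewrite -(iint_orthant_sum (fun i => z * v 0 (inord i)) n (fun i => if i == n.+1 then y
    else if i == n.+2 then z else 0) s2 _ (phi0 y)); last first.
    apply: measurable_fun_ifT => //; apply: measurable_and; last apply: measurable_and;
      exact: measurable_fun_ler.
  apply: (@eq_iint _ n.+1) => x xE; rewrite !xE//= eqxx gtn_eqF// eqxx indicE.
  have sE : \sum_(i < n.+1) s * ((\row_(j < n.+1) x j) 0 i - z * v 0 i)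
      = \sum_(i < n.+1) s * (x i - z * v 0 (inord i)).
    by apply: eq_bigr => i _; rewrite mxE inord_val.
  have := SE (\row_(j < n.+1) x j) y z z0; rewrite sE => Sxyz.
  rewrite (_ : (_ \in S) = [forall i : 'I_n.+1, 0 <= s * (x i - z * v 0 (inord i))]
    && [&& \sum_(i < n.+1) s * (x i - z * v 0 (inord i)) <= z * u,
      lo z (\sum_(i < n.+1) s * (x i - z * v 0 (inord i))) <= y
      & y <= up z (\sum_(i < n.+1) s * (x i - z * v 0 (inord i)))]).
    by rewrite /phi; case: ifP => _ //=; case: ifP.
  apply/idP/idP => [/set_mem/Sxyz[_ x0 -> -> ->]|/andP[/forallP x0 /and3P[? ? ?]]].
    by rewrite !andbT; apply/forallP => i; have := x0 i; rewrite mxE inord_val.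
  apply/mem_set/Sxyz; split => // i; have := x0 i; by rewrite mxE inord_val.
(* For fixed [r] in [[0, z * u]], the [y]-integral is the length of [[lo z r, up z r]] times the
   density. *)
rewrite fubini_tonelli// -gE// [RHS]integral_mkcond; apply: eq_integral => r _.
rewrite patchE mem_setE in_itv/= /k/= /phi.
have [r0|r0] := leP 0 r; last by rewrite integral0.
have [ru|ru] := leP r (z * u); last first.
  by apply: integral0_eq => y _ /=; rewrite mul0e.
have W0 := monomial_density_ge0 n r0.
transitivity (\int[@lebesgue_measure R]_y ((\1_(`[lo z r, up z r]%classic) y)%:E
   * (monomial_density n r)%:E))%E.
  apply: eq_integral => y _; rewrite /= indicE mem_setE in_itv/=.
  by case: ifP.
rewrite ge0_integralZr//; last by apply/measurable_EFinP; exact: measurable_indic.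
rewrite integral_indic// setIT [X in (X * _)%E]lebesgue_measure_itv/= EFinM lte_fin.
(* The measure of an interval is given by cases on strict order of its ends; when the two faces
   meet, both sides are 0. *)
have := loup z r z01; rewrite r0 ru => /(_ isT); rewrite le_eqVlt => /orP[/eqP ->|->//].
by rewrite ltxx subrr.
Qed.

(** * Convexity of the exponential function *)

(** The tangent at the mean [m] lies below the graph. In the weighted sum of the tangent bounds at
    [a] and [b] the deviations from [m] cancel, which leaves [expR m]. *)
Lemma expR_convex_comb (R : realType) (t a b : R) : 0 <= t <= 1 ->
  expR ((1 - t) * a + t * b) <= (1 - t) * expR a + t * expR b.
Proof.
move=> /andP[t0 t1]; set m := (1 - t) * a + t * b.
have tangent x : expR m * (1 + (x - m)) <= expR x.
  have -> : expR x = expR m * expR (x - m) by rewrite -expRD addrC subrK.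
  by rewrite ler_pM2l ?expR_gt0// expR_ge1Dx.
have ha : (1 - t) * (expR m * (1 + (a - m))) <= (1 - t) * expR a.
  by apply: ler_wpM2l => //; rewrite subr_ge0.
have hb : t * (expR m * (1 + (b - m))) <= t * expR b by apply: ler_wpM2l.
apply: le_trans (lerD ha hb).
rewrite [leRHS](_ : _ = expR m) // /m; ring.
Qed.

(** * Barycentric coordinates and affine interpolation on the simplices *)

(* Cases (a) and (b) are [s = -1] and [s = 1]. *)
Definition signed_verts {R : realType} d (s : R) (v : 'rV[R]_d) (u : R) :
    'I_d.+1 -> 'rV[R]_d :=
  fun i => if unlift ord0 i is Some j then v + (s * u) *: unitv R j else v.

Lemma verts_aE (R : realType) d (k u : R) :
  verts_a k u = signed_verts (-1) ((k * u) *: onesv R d) u.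
Proof.
by apply/funext => i; rewrite /verts_a /signed_verts mulN1r; case: unlift => // j; rewrite scaleNr.
Qed.

Lemma verts_bE (R : realType) d (v : 'rV[R]_d) (u : R) :
  verts_b v u = signed_verts 1 v u.
Proof. by apply/funext => i; rewrite /verts_b /signed_verts mul1r. Qed.

Section SignedSimplex.
Variables (R : realType) (d : nat) (s u : R) (v : 'rV[R]_d).
Hypotheses (s2 : s ^+ 2 = 1) (u_gt0 : 0 < u).

Let w := signed_verts s v u.

Let w0 : w ord0 = v. Proof. by rewrite /w /signed_verts unlift_none. Qed.

Let wS j : w (lift ord0 j) = v + (s * u) *: unitv R j.
Proof. by rewrite /w /signed_verts liftK. Qed.

Let comb_coord (lam : 'I_d.+1 -> R) (i : 'I_d) : \sum_j lam j = 1 ->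
  (\sum_j lam j *: w j) 0 i = v 0 i + s * u * lam (lift ord0 i).
Proof.
move=> lam1; rewrite big_ord_recl w0 mxE summxE.
under eq_bigr do rewrite wS !mxE mulrDr.
rewrite big_split/= [X in _ + (_ + X)](bigD1 i)//= eqxx [X in _ + (_ + (_ + X))]big1 => [|j ji]; last first.
  by rewrite eq_sym (negbTE ji) !mulr0.
rewrite -mulr_suml (_ : \sum_j lam (lift ord0 j) = 1 - lam ord0); first by rewrite mxE mulr1; ring.
by rewrite -lam1 big_ord_recl; ring.
Qed.

(** The barycentric weight of the vertex in direction [j] is [s * (x 0 j - v 0 j) / u], because [s]
    is its own inverse, and [v] takes the remaining weight. The two conditions say that all weights
    are nonnegative. *)
Lemma conv_signed_verts (x : 'rV[R]_d) : Defs.conv w x <->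
  (forall j, 0 <= s * (x 0 j - v 0 j)) /\ \sum_j s * (x 0 j - v 0 j) <= u.
Proof.
have u0 : u != 0 by rewrite gt_eqF.
split=> [[lam [lam0 [lam1 ->]]]|[x0 xu]].
  have E j : s * ((\sum_i lam i *: w i) 0 j - v 0 j) = u * lam (lift ord0 j).
    rewrite comb_coord//; transitivity (s ^+ 2 * u * lam (lift ord0 j)); first ring.
    by rewrite s2 mul1r.
  split=> [j|]; first by rewrite E mulr_ge0// ltW.
  under eq_bigr do rewrite E.
  rewrite -mulr_sumr -[leRHS]mulr1 ler_pM2l// -lam1 [leRHS]big_ord_recl lerDr.
  exact: lam0.
pose lam i := if unlift ord0 i is Some j then s * (x 0 j - v 0 j) / u
  else 1 - (\sum_j s * (x 0 j - v 0 j)) / u.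
have lam0 : lam ord0 = 1 - (\sum_j s * (x 0 j - v 0 j)) / u by rewrite /lam unlift_none.
have lamS j : lam (lift ord0 j) = s * (x 0 j - v 0 j) / u by rewrite /lam liftK.
have lam1 : \sum_j lam j = 1.
  rewrite big_ord_recl lam0 mulr_suml.
  by under [X in _ + X]eq_bigr do rewrite lamS; rewrite subrK.
exists lam; split; last split => //.
  move=> i; rewrite /lam; case: unlift => [j|]; first by rewrite divr_ge0// ltW.
  by rewrite subr_ge0 ler_pdivrMr// mul1r.
apply/rowP => i; rewrite comb_coord// lamS.
transitivity (v 0 i + s ^+ 2 * (x 0 i - v 0 i)); first by rewrite s2; ring.
by field.
Qed.

Lemma scale_conv_signed_verts (x : 'rV[R]_d) (z : R) : 0 < z ->
  scale_set z (Defs.conv w) x <->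
  (forall j, 0 <= s * (x 0 j - z * v 0 j)) /\
  \sum_j s * (x 0 j - z * v 0 j) <= z * u.
Proof.
move=> z0; have zn0 : z != 0 by rewrite gt_eqF.
have E (y : 'rV[R]_d) j : s * ((z *: y) 0 j - z * v 0 j) = z * (s * (y 0 j - v 0 j)).
  by rewrite mxE; ring.
split=> [[y /conv_signed_verts[y0 yu] <-]|[x0 xu]].
  split=> [j|]; first by rewrite E mulr_ge0// ltW.
  by under eq_bigr do rewrite E; rewrite -mulr_sumr ler_pM2l.
exists (z^-1 *: x); last by rewrite scalerA divff// scale1r.
have F j : s * (x 0 j - z * v 0 j) = z * (s * ((z^-1 *: x) 0 j - v 0 j)).
  by rewrite -E scalerA divff// scale1r.
apply/conv_signed_verts; split=> [j|].
  by have := x0 j; rewrite F pmulr_rge0.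
move: xu; rewrite (eq_bigr _ (fun j _ => F j)).
by rewrite -[X in X <= z * u]mulr_sumr ler_pM2l.
Qed.

(** All vertices other than [v] share the value [e1], so the interpolant has the same slope
    [s * (e1 - e0) / u] in every coordinate. *)
Lemma mu_hom_signed_verts (g : 'rV[R]_d -> R) (e0 e1 : R) (x : 'rV[R]_d) (z : R) :
  g v = e0 -> (forall j, g (v + (s * u) *: unitv R j) = e1) ->
  mu_hom (affine_interp w g) x z =
  z * e0 + (e1 - e0) / u * \sum_j s * (x 0 j - z * v 0 j).
Proof.
move=> gv gw; have u0 : u != 0 by rewrite gt_eqF.
have dotw (a : 'rV[R]_d) j : dotv a (v + (s * u) *: unitv R j) = dotv a v + s * u * a 0 j.
  rewrite /dotv; under eq_bigr do rewrite !mxE mulrDr.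
  rewrite big_split/= [X in _ + X](bigD1 j)//= eqxx [X in _ + (_ + X)]big1 => [|i ij]; last first.
    by rewrite (negbTE ij) !mulr0.
  by rewrite mulr1; ring.
pose a0 : 'rV[R]_d := \row_j (s * (e1 - e0) / u).
(* [xget] falls back on the default [(0, 0)] unless some interpolant exists, so one is exhibited
   first. *)
have /(@xgetPex _ (0, 0)) : exists ab : 'rV[R]_d * R,
    [set ab | forall i, dotv ab.1 (w i) + ab.2 = g (w i)] ab.
  exists (a0, e0 - dotv a0 v) => i /=.
  have [j|] := unliftP ord0 i => ->; last by rewrite w0 gv; ring.
  rewrite wS gw dotw mxE; transitivity (e0 + s ^+ 2 * (e1 - e0)); first by field.
  by rewrite s2; ring.
rewrite -/(affine_interp w g); case: (affine_interp w g) => a b /= ab.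
have := ab ord0; rewrite w0 gv => ab0.
(* Subtracting the vertex condition at [v] from the one in direction [j] isolates the coefficient,
   so the chosen interpolant has the exhibited slopes. *)
have aE j : a 0 j = s * (e1 - e0) / u.
  have := ab (lift ord0 j); rewrite wS gw dotw => ab1.
  have h : s * u * a 0 j = e1 - e0 by rewrite -ab1 -ab0; ring.
  rewrite -h; transitivity (s ^+ 2 * a 0 j); first by rewrite s2 mul1r.
  by field.
rewrite /mu_hom/= (_ : b = e0 - dotv a v); last by rewrite -ab0; ring.
rewrite mulrBr addrCA; congr (_ + _); rewrite /dotv.
rewrite !mulr_sumr -sumrB; apply: eq_bigr => j _; rewrite aE; ring.
Qed.

End SignedSimplex.

(** * The faces bounding [y] *)

(** In this and the next two functions [c] is the coordinate sum of [v] and [r] that of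
    [s * (x - z v)]. They are the homogenized interpolant, the function [f] and its perspective. *)
Definition upper_face {R : realType} (c s u z r : R) : R :=
  z * (expR c - 1) + (expR (c + s * u) - expR c) / u * r.

Definition naive_face {R : realType} (c s z r : R) : R := expR (z * c + s * r) - 1.

Definition persp_face {R : realType} (c s z r : R) : R :=
  z * (expR (c + s * r / z) - 1).

(** Convexity between 0, with weight [1 - z], and [c + s * r / z], with weight [z]; the constants
    match since [f] vanishes at the origin. *)
Lemma naive_le_persp_face (R : realType) (c s z r : R) : 0 < z <= 1 ->
  naive_face c s z r <= persp_face c s z r.
Proof.
move=> /andP[z0 z1]; have zn0 : z != 0 by rewrite gt_eqF.
have := @expR_convex_comb _ z 0 (c + s * r / z).
rewrite (ltW z0) z1 expR0 => /(_ isT).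
rewrite (_ : (1 - z) * 0 + z * (c + s * r / z) = z * c + s * r); last by field.
by rewrite /naive_face /persp_face; lra.
Qed.

(** The point [c + s * r / z] divides the segment from [c] to [c + s * u] with weight [r / (z * u)].
    The bound is the chord inequality there, multiplied by [z]. *)
Lemma persp_le_upper_face (R : realType) (c s u z r : R) : 0 < u -> 0 < z ->
  0 <= r <= z * u -> persp_face c s z r <= upper_face c s u z r.
Proof.
move=> u0 z0 /andP[r0 ru].
have un0 : u != 0 by rewrite gt_eqF.
have zn0 : z != 0 by rewrite gt_eqF.
have t01 : 0 <= r / (z * u) <= 1.
  by rewrite divr_ge0 ?mulr_ge0 ?(ltW z0) ?(ltW u0)//= ler_pdivrMr ?mul1r// mulr_gt0.
have := expR_convex_comb c (c + s * u) t01.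
rewrite (_ : _ + _ * (c + s * u) = c + s * r / z); last by field; rewrite un0 zn0.
rewrite -(ler_pM2l z0) => h; rewrite /persp_face mulrBr.
apply: le_trans (lerB h (lexx _)) _.
by rewrite /upper_face le_eqVlt; apply/orP; left; apply/eqP; field; rewrite un0 zn0.
Qed.

(** Otherwise [h < 0] on a neighbourhood of [p], which would miss [A]. Continuity is asked only at
    [p], which suits the quotient by [z] in [persp_face]. *)
Lemma closure_ge0 (T : topologicalType) (R : realType) (A : set T) (h : T -> R) (p : T) :
  {for p, continuous h} -> (forall q, A q -> 0 <= h q) -> closure A p -> 0 <= h p.
Proof.
move=> ch hA clA; rewrite leNgt; apply/negP => hp0.
have /clA[q [/hA]] : nbhs p [set q | h q < 0] by exact: (cvgr_lt (h p) ch).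
by rewrite leNgt => /negP.
Qed.

(** * Slices of the two relaxations at a nonzero height *)

Section Slices.
Variables (R : realType) (d : nat) (s u : R) (v : 'rV[R]_d).
Hypotheses (s2 : s ^+ 2 = 1) (u_gt0 : 0 < u).

Let w := signed_verts s v u.
Let c := \sum_j v 0 j.
Let coord_sum (x : 'rV[R]_d) (z : R) := \sum_j s * (x 0 j - z * v 0 j).

Let sumE (x : 'rV[R]_d) (z : R) : \sum_j x 0 j = z * c + s * coord_sum x z.
Proof.
rewrite /coord_sum /c !mulr_sumr -big_split/=; apply: eq_bigr => j _.
by rewrite mulrA -expr2 s2; ring.
Qed.

Let mu_homE (x : 'rV[R]_d) (z : R) :
  mu_hom (affine_interp w (@fexp R d)) x z = upper_face c s u z (coord_sum x z).
Proof.
rewrite (@mu_hom_signed_verts _ _ _ _ _ s2 u_gt0 _ (expR c - 1) (expR (c + s * u) - 1))//.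
  by rewrite /upper_face -/(coord_sum x z) opprB addrA subrK.
move=> j; rewrite /fexp; congr (expR _ - 1).
under eq_bigr do rewrite !mxE; rewrite big_split/= -/c; congr (_ + _).
rewrite (bigD1 j)//= eqxx big1 => [|i ij]; last by rewrite (negbTE ij) mulr0.
by rewrite mulr1 addr0.
Qed.

Lemma naive_relax_slice (x : 'rV[R]_d) (y z : R) : z != 0 ->
  naive_relax (@fexp R d) w ((x, y), z) <->
  [/\ 0 < z <= 1, forall i, 0 <= s * (x 0 i - z * v 0 i),
    coord_sum x z <= z * u, naive_face c s z (coord_sum x z) <= y
    & y <= upper_face c s u z (coord_sum x z)].
Proof.
move=> zn0; rewrite /naive_relax/= mu_homE /fexp (sumE x z).
split=> [[yup [loy [xJ [z0 z1]]]]|[/andP[z0 z1] x0 xu loy yup]].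
  have {}z0 : 0 < z by rewrite lt_def zn0.
  by move/scale_conv_signed_verts : xJ => /(_ s2 u_gt0 z0)[x0 xu]; split => //; rewrite z0.
do 2 (split => //); split; last by rewrite ltW.
exact/scale_conv_signed_verts.
Qed.

(** The closure adds no point with [z != 0]: each defining inequality compares functions continuous
    at such a point, and so passes to the limit. *)
Lemma persp_relax_slice (x : 'rV[R]_d) (y z : R) : z != 0 ->
  persp_relax (@fexp R d) w ((x, y), z) <->
  [/\ 0 < z <= 1, forall i, 0 <= s * (x 0 i - z * v 0 i),
    coord_sum x z <= z * u, persp_face c s z (coord_sum x z) <= y
    & y <= upper_face c s u z (coord_sum x z)].
Proof.
move=> zn0; rewrite /persp_relax.
have perspE (x' : 'rV[R]_d) z' : 0 < z' ->
    z' * fexp (z'^-1 *: x') = persp_face c s z' (coord_sum x' z').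
  move=> z'0; rewrite /fexp /persp_face; congr (_ * (expR _ - 1)).
  under eq_bigr do rewrite mxE; rewrite -mulr_sumr (sumE x' z').
  by field; rewrite gt_eqF.
set A := (X in closure X); split; last first.
  move=> [/andP[z0 z1] x0 xu loy yup]; apply: subset_closure.
  rewrite /A/= mu_homE perspE//; do 2 (split => //); split => //.
  exact/scale_conv_signed_verts.
have coord_continuous_fst j : continuous (fun p : 'rV[R]_d * R * R => p.1.1 0 j).
  move=> p.
  apply: (@continuous_comp _ _ _ (fun p : 'rV[R]_d * R * R => p.1.1) (fun x : 'rV[R]_d => x 0 j)).
    apply: (@continuous_comp _ _ _ fst fst); exact: cvg_fst.
  exact: coord_continuous.
have snd_continuous : continuous (fun p : 'rV[R]_d * R * R => p.2).
  by move=> p; exact: cvg_snd.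
have mid_continuous : continuous (fun p : 'rV[R]_d * R * R => p.1.2).
  move=> p; apply: (@continuous_comp _ _ _ fst snd); [exact: cvg_fst|exact: cvg_snd].
have term_continuous j : continuous (fun p : 'rV[R]_d * R * R => s * (p.1.1 0 j - p.2 * v 0 j)).
  move=> p; apply: cvgM; first exact: cvg_cst.
  apply: cvgB; first exact: coord_continuous_fst.
  by apply: cvgM; [exact: snd_continuous|exact: cvg_cst].
have sum_continuous : continuous (fun p : 'rV[R]_d * R * R => coord_sum p.1.1 p.2).
  move=> p; rewrite /coord_sum; apply: cvg_big => [|j _]; [exact: add_continuous|exact: term_continuous].
move=> clA.
(* Only [0 <= z] survives the closure; [zn0] restores strictness. *)
have z0 : 0 < z.
  rewrite lt_def zn0/=.
  apply: (closure_ge0 (h := fun p : 'rV[R]_d * R * R => p.2) _ _ clA).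
    exact: snd_continuous.
  by move=> q [_ [_ [_ [/ltW]]]].
have z1 : 0 <= 1 - z.
  apply: (closure_ge0 (h := fun p : 'rV[R]_d * R * R => 1 - p.2) _ _ clA).
    by apply: cvgB; [exact: cvg_cst|exact: snd_continuous].
  by move=> q [_ [_ [_ [_]]]]; rewrite subr_ge0.
have AE q : A q -> [/\ 0 < q.2, forall j, 0 <= s * (q.1.1 0 j - q.2 * v 0 j),
    coord_sum q.1.1 q.2 <= q.2 * u, persp_face c s q.2 (coord_sum q.1.1 q.2) <= q.1.2
    & q.1.2 <= upper_face c s u q.2 (coord_sum q.1.1 q.2)].
  move=> [yup [loy [xJ [q0 _]]]].
  move/scale_conv_signed_verts : xJ => /(_ s2 u_gt0 q0)[x0 xu].
  by split => //; rewrite -?perspE// -?mu_homE.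
split; first by rewrite z0 -subr_ge0.
- move=> j; apply: (closure_ge0 (h := fun p : 'rV[R]_d * R * R => s * (p.1.1 0 j - p.2 * v 0 j)) _ _ clA).
    exact: term_continuous.
  by move=> q /AE[].
- rewrite -subr_ge0.
  apply: (closure_ge0 (h := fun p : 'rV[R]_d * R * R => p.2 * u - coord_sum p.1.1 p.2) _ _ clA).
    apply: cvgB; last exact: sum_continuous.
    by apply: cvgM; [exact: snd_continuous|exact: cvg_cst].
  by move=> q /AE[]; rewrite subr_ge0.
- rewrite -subr_ge0.
  apply: (closure_ge0 (h := fun p : 'rV[R]_d * R * R => p.1.2 - persp_face c s p.2 (coord_sum p.1.1 p.2)) _ _ clA).
    apply: cvgB; first exact: mid_continuous.
    apply: cvgM; first exact: snd_continuous.
    apply: cvgB; last exact: cvg_cst.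
    apply: (@continuous_comp _ _ _ (fun p : 'rV[R]_d * R * R =>
      c + s * coord_sum p.1.1 p.2 / p.2) expR); last exact: continuous_expR.
    apply: cvgD; first exact: cvg_cst.
    apply: cvgM; last by apply: cvgV => //; exact: snd_continuous.
    by apply: cvgM; [exact: cvg_cst|exact: sum_continuous].
  by move=> q /AE[]; rewrite subr_ge0.
- rewrite -subr_ge0.
  apply: (closure_ge0 (h := fun p : 'rV[R]_d * R * R => upper_face c s u p.2 (coord_sum p.1.1 p.2) - p.1.2) _ _ clA).
    apply: cvgB; last exact: mid_continuous.
    apply: cvgD; apply: cvgM; try exact: cvg_cst.
      exact: snd_continuous.
    exact: sum_continuous.
  by move=> q /AE[]; rewrite subr_ge0.
Qed.

End Slices.

(** * Primitives of an exponential times a monomial *)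

(* The primitive of [expR (l * x) * x ^+ m / m`!] vanishing at [0], by repeated
   integration by parts. *)
Fixpoint exp_monomial_primitive {R : realType} (l : R) (m : nat) (x : R) : R :=
  match m with
  | 0 => (expR (l * x) - 1) / l
  | m'.+1 => (expR (l * x) * monomial_density m x - exp_monomial_primitive l m' x) / l
  end.

Section ExpMonomialPrimitive.
Variables (R : realType) (l : R).
Hypothesis l_neq0 : l != 0.

Local Notation A := (exp_monomial_primitive l).

Let is_derive_expMl (x : R) : is_derive x 1 (fun x => expR (l * x)) (l * expR (l * x)).
Proof.
have h : is_derive x 1 (fun x : R => l * x) (l *: 1) by exact: is_deriveZ.
have := @is_derive1_comp R expR (fun x : R => l * x) x _ _ (is_derive_expR _) h.
by move=> h'; apply: is_derive_eq; rewrite /GRing.scale/= mulr1 mulrC.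
Qed.

Lemma is_derive_exp_monomial_primitive m (x : R) :
  is_derive x 1 (A m) (expR (l * x) * monomial_density m x).
Proof.
elim: m => [|m IH].
  rewrite /monomial_density expr0 fact0 divr1 mulr1.
  rewrite (_ : A 0 = l^-1 \*: ((fun x => expR (l * x)) - cst 1)).
    apply: is_derive_eq; by rewrite /GRing.scale/=; field.
  by apply/funext => y /=; rewrite mulrC.
rewrite (_ : A m.+1 =
    l^-1 \*: ((fun x => expR (l * x)) * (@monomial_density R m.+1) - A m)).
  have dM := is_derive_monomial_density m x.
  apply: is_derive_eq; rewrite /GRing.scale/=; by field.
by apply/funext => y /=; rewrite mulrC.
Qed.

Lemma continuous_exp_monomial_primitive m : continuous (A m).
Proof.
move=> x; apply: differentiable_continuous; apply/derivable1_diffP.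
by case: (is_derive_exp_monomial_primitive m x).
Qed.

Lemma exp_monomial_primitive0 m : A m 0 = 0.
Proof.
elim: m => [|m IH] /=; first by rewrite mulr0 expR0 subrr mul0r.
by rewrite IH /monomial_density expr0n/= mul0r mulr0 subr0 mul0r.
Qed.

(** The recursion subtracts, so the sign is read off from the integral of a nonnegative function
    over [[0, x]]; it holds for either sign of [l]. *)
Lemma exp_monomial_primitive_ge0 m x : 0 <= x -> 0 <= A m x.
Proof.
move=> x0.
have cf : continuous (fun x => expR (l * x) * monomial_density m x).
  move=> r; apply: cvgM; last exact: continuous_monomial_density.
  apply: (@continuous_comp _ _ _ (fun r => l * r) expR); last exact: continuous_expR.
  by apply: cvgM; [exact: cvg_cst|exact: cvg_id].
have := integral_itv_antiderivative x0 cf (is_derive_exp_monomial_primitive m).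
rewrite exp_monomial_primitive0 subr0 -lee_fin => <-.
apply: integral_ge0 => r /=; rewrite in_itv/= => /andP[r0 _].
by rewrite lee_fin mulr_ge0 ?expR_ge0// monomial_density_ge0.
Qed.

End ExpMonomialPrimitive.

(** This is the substitution [r = z t] in the integral, carried out on the recursion: the monomial
    gives [z ^+ m] and the differential one more [z]. *)
Lemma exp_monomial_primitive_scale (R : realType) (l z x : R) m : z != 0 -> l != 0 ->
  exp_monomial_primitive (l / z) m (z * x) = z ^+ m.+1 * exp_monomial_primitive l m x.
Proof.
move=> z0 l0; have lzx : l / z * (z * x) = l * x by field.
elim: m => [|m IH] /=; rewrite lzx; first by field; rewrite l0 z0.
rewrite IH /monomial_density exprMn [z ^+ m.+2]exprS.
by field; rewrite l0 z0 pnatr_eq0 -lt0n fact_gt0.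
Qed.

(** * The two volumes *)

Section Volumes.
Variables (R : realType) (n : nat) (s u : R) (v : 'rV[R]_n.+1).
Hypotheses (s2 : s ^+ 2 = 1) (u_gt0 : 0 < u).

Let w := signed_verts s v u.
Let c := \sum_j v 0 j.
Local Notation W := (@monomial_density R).
Local Notation A := (exp_monomial_primitive s n).

Let un0 : u != 0. Proof. by rewrite gt_eqF. Qed.
Let sn0 : s != 0. Proof. by apply: contra_eq_neq s2 => ->; rewrite expr0n eq_sym oner_eq0. Qed.

(* The dimension is [d = n.+1]. *)
Definition interp_integral (c' : R) : R :=
  W n.+1 u * ((expR c' - 1) + (expR (c' + s * u) - expR c') * (n.+1%:R / n.+2%:R)).

(** The contribution of the exponential to the naive volume: the integrand is the integral of
    [expR (z * c' + s * r)] against the density over [0 <= r <= z * u]. It stays an integral and is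
    only estimated. *)
Definition naive_tail (c' : R) : R :=
  (\int[@lebesgue_measure R]_(z in `[0%R, 1%R]) (expR (z * c') * A (z * u)))%R.

Let B := interp_integral c.

(** Primitive in [r] of the upper face times the density; the factor [n.+1%:R] comes from
    [r * W n r = n.+1%:R * W n.+1 r]. *)
Let upper_primitive (z r : R) : R :=
  z * (expR c - 1) * W n.+1 r
  + (expR (c + s * u) - expR c) / u * (n.+1%:R * W n.+2 r).

Let upper_primitiveE (z : R) :
  upper_primitive z (z * u) = z ^+ n.+2 * B.
Proof.
rewrite /upper_primitive /B /interp_integral /monomial_density.
rewrite [(n.+2)`!]factS natrM !exprMn [z ^+ n.+2]exprS [u ^+ n.+2]exprS.
by field; rewrite ?un0 -?natrD ?nat1r !pnatr_eq0 -?lt0n ?fact_gt0.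
Qed.

(** Shared by both relaxations: [f] is a lower face at height [z], and [F] its primitive against the
    density. *)
Let slice_integral (f F : R -> R) (z : R) : 0 <= z -> continuous f ->
  (forall x : R, is_derive x 1 F (f x * W n x)) -> F 0 = 0 ->
  (\int[@lebesgue_measure R]_(r in `[0%R, (z * u)%R])
     ((upper_face c s u z r - f r) * W n r)%:E
   = (z ^+ n.+2 * B - F (z * u))%:E)%E.
Proof.
move=> z0 cf dF F0.
have cg : continuous (fun r => (upper_face c s u z r - f r) * W n r).
  move=> r; apply: cvgM; last exact: continuous_monomial_density.
  apply: cvgB; last exact: cf.
  apply: cvgD; first exact: cvg_cst.
  by apply: cvgM; [exact: cvg_cst|exact: cvg_id].
have dG (r : R) : is_derive r 1 (upper_primitive z - F)
    ((upper_face c s u z r - f r) * W n r).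
  have d1 := is_derive_monomial_density n r.
  have d2 := is_derive_monomial_density n.+1 r.
  have -> : upper_primitive z = (z * (expR c - 1)) \*: W n.+1
     + ((expR (c + s * u) - expR c) / u * n.+1%:R) \*: W n.+2.
    by apply/funext => t; rewrite /upper_primitive/= mulrA.
  have dFr := dF r.
  apply: is_derive_eq; rewrite /GRing.scale/= /upper_face /monomial_density.
  rewrite factS natrM exprS.
  by field; rewrite ?un0 -?natrD ?nat1r !pnatr_eq0 -?lt0n ?fact_gt0.
rewrite (integral_itv_antiderivative _ cg dG) ?mulr_ge0 ?(ltW u_gt0)//.
have -> : (upper_primitive z - F) (z * u) = z ^+ n.+2 * B - F (z * u).
  by rewrite -upper_primitiveE.
have -> : (upper_primitive z - F) 0 = upper_primitive z 0 - F 0 by [].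
by rewrite F0 /upper_primitive /monomial_density !expr0n/= !mul0r !mulr0 !addr0 !subr0.
Qed.

Let continuous_expRMl (k : R) : continuous (fun r : R => expR (k * r)).
Proof.
move=> r; apply: (@continuous_comp _ _ _ (fun r => k * r) expR); last exact: continuous_expR.
by apply: cvgM; [exact: cvg_cst|exact: cvg_id].
Qed.

Let continuous_affine (k0 k1 : R) : continuous (fun r : R => k0 + k1 * r).
Proof.
move=> r; apply: cvgD; first exact: cvg_cst.
by apply: cvgM; [exact: cvg_cst|exact: cvg_id].
Qed.

Let continuous_naive_face (z : R) : continuous (naive_face c s z).
Proof.
move=> r; apply: cvgB; last exact: cvg_cst.
apply: (@continuous_comp _ _ _ (fun r => z * c + s * r) expR); last exact: continuous_expR.
exact: continuous_affine.
Qed.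

Let persp_faceE (z : R) : persp_face c s z = fun r => z * expR c * expR (s / z * r) - z.
Proof.
by apply/funext => r; rewrite /persp_face (mulrAC s r) expRD; ring.
Qed.

Let continuous_persp_face (z : R) : continuous (persp_face c s z).
Proof.
rewrite persp_faceE => r; apply: cvgB; last exact: cvg_cst.
by apply: cvgM; [exact: cvg_cst|exact: continuous_expRMl].
Qed.

Let measurable_upper_face (z : R) : measurable_fun [set: R] (upper_face c s u z).
Proof. by apply: continuous_measurable_fun; exact: continuous_affine. Qed.

Let continuous_tail : continuous (fun z : R => expR (z * c) * A (z * u)).
Proof.
move=> z; apply: cvgM.
  under eq_cvg do rewrite mulrC; rewrite mulrC; exact: continuous_expRMl.
apply: (@continuous_comp _ _ _ (fun z : R => z * u) A); last exact: continuous_exp_monomial_primitive.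
by apply: cvgM; [exact: cvg_id|exact: cvg_cst].
Qed.

Let continuous_powers (a b : R) : continuous (fun z : R => z ^+ n.+2 * a + z ^+ n.+1 * b).
Proof.
by move=> z; apply: cvgD; apply: cvgM; try exact: cvg_cst; exact: exprn_continuous.
Qed.

Let integral_powers (a b : R) :
  (\int[@lebesgue_measure R]_(z in `[0%R, 1%R]) (z ^+ n.+2 * a + z ^+ n.+1 * b)%:E
   = (a / n.+3%:R + b / n.+2%:R)%:E)%E.
Proof.
pose F := (a * n.+2`!%:R) \*: W n.+3 + (b * n.+1`!%:R) \*: W n.+2.
have dF (z : R) : is_derive z 1 F (z ^+ n.+2 * a + z ^+ n.+1 * b).
  have d1 := is_derive_monomial_density n.+1 z.
  have d2 := is_derive_monomial_density n.+2 z.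
  apply: is_derive_eq; rewrite /GRing.scale/= /monomial_density ?factS ?natrM.
  by field; rewrite -?natrD ?nat1r !pnatr_eq0 -?lt0n ?fact_gt0.
rewrite (integral_itv_antiderivative ler01 (@continuous_powers a b) dF); congr (_%:E).
have FE z : F z = a * n.+2`!%:R * W n.+3 z + b * n.+1`!%:R * W n.+2 z by [].
rewrite !FE /monomial_density !expr1n !expr0n/= ?factS ?natrM.
by field; rewrite -?natrD ?nat1r !pnatr_eq0 -?lt0n ?fact_gt0.
Qed.

(** Continuous functions on a compact interval have finite integrals, so [fine] respects the
    difference. *)
Let fine_integralB (p q : R -> R) : continuous p -> continuous q ->
  fine (\int[@lebesgue_measure R]_(z in `[0%R, 1%R]) (p z - q z)%:E)%E
  = fine (\int[@lebesgue_measure R]_(z in `[0%R, 1%R]) (p z)%:E)%E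
    - (\int[@lebesgue_measure R]_(z in `[0%R, 1%R]) q z)%R.
Proof.
move=> cp cq.
have int (f : R -> R) : continuous f ->
    (@lebesgue_measure R).-integrable `[0%R, 1%R] (EFin \o f).
  move=> cf; apply: continuous_compact_integrable; first exact: segment_compact.
  exact: continuous_subspaceT.
apply: RintegralB => //; exact: int.
Qed.

(** In the slice at height [z], the upper face gives [z ^+ n.+2 * B], the constant -1 in [f] gives
    [z ^+ n.+1 * W n.+1 u], and the exponential gives the integrand of [naive_tail]. *)
Lemma vol_naive_relax : fine (vol (naive_relax (@fexp R n.+1) w))
  = B / n.+3%:R + W n.+1 u / n.+2%:R - naive_tail c.
Proof.
rewrite (@vol_region R n s u v _ (naive_face c s) (upper_face c s u)
   (fun z => z ^+ n.+2 * B + z ^+ n.+1 * W n.+1 u - expR (z * c) * A (z * u)))//.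
- by rewrite fine_integralB// ?integral_powers//; exact: continuous_powers.
- by move=> z; apply: continuous_measurable_fun; exact: continuous_naive_face.
- move=> z r z01 ru; apply: le_trans (persp_le_upper_face c s u_gt0 _ ru); last by case/andP: z01.
  exact: naive_le_persp_face.
- by move=> x y z zn0; exact: naive_relax_slice.
- apply: measurable_funB; apply: continuous_measurable_fun; first exact: continuous_powers.
  exact: continuous_tail.
move=> z /andP[z0 z1].
pose F r := expR (z * c) * A r - W n.+1 r.
have dF (r : R) : is_derive r 1 F (naive_face c s z r * W n r).
  have d1 := is_derive_monomial_density n r.
  have d2 := is_derive_exp_monomial_primitive sn0 n r.
  have -> : F = expR (z * c) \*: A - W n.+1 by [].
  apply: is_derive_eq; rewrite /naive_face /GRing.scale/= expRD; ring.
have F0 : F 0 = 0.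
  by rewrite /F exp_monomial_primitive0 /monomial_density expr0n/= !mul0r mulr0 subrr.
rewrite (slice_integral (ltW z0) (@continuous_naive_face z) dF F0) /F.
congr (_%:E); rewrite /monomial_density exprMn; ring.
Qed.

(** The perspective region is conical: its slice at height [z] is [z ^+ n.+2] times the one at
    height 1, and integrating the power gives the denominator [d + 2]. The summand with coefficient
    0 only puts the integrand in the form of [integral_powers]. *)
Lemma vol_persp_relax : fine (vol (persp_relax (@fexp R n.+1) w))
  = (B + W n.+1 u - expR c * A u) / n.+3%:R.
Proof.
rewrite (@vol_region R n s u v _ (persp_face c s) (upper_face c s u)
   (fun z => z ^+ n.+2 * (B + W n.+1 u - expR c * A u) + z ^+ n.+1 * 0))//.
- by rewrite integral_powers/= mul0r addr0.
- by move=> z; apply: continuous_measurable_fun; exact: continuous_persp_face.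
- by move=> z r /andP[z0 z1] ru; exact: persp_le_upper_face.
- by move=> x y z zn0; exact: persp_relax_slice.
- by apply: continuous_measurable_fun; exact: continuous_powers.
move=> z /andP[z0 z1]; have zn0 : z != 0 by rewrite gt_eqF.
have szn0 : s / z != 0 by rewrite mulf_neq0// invr_eq0.
pose F r := z * expR c * exp_monomial_primitive (s / z) n r - z * W n.+1 r.
have dF (r : R) : is_derive r 1 F (persp_face c s z r * W n r).
  have d1 := is_derive_monomial_density n r.
  have d2 := is_derive_exp_monomial_primitive szn0 n r.
  have -> : F = (z * expR c) \*: exp_monomial_primitive (s / z) n - z \*: W n.+1 by [].
  apply: is_derive_eq; rewrite persp_faceE /GRing.scale/=; ring.
have F0 : F 0 = 0.
  by rewrite /F exp_monomial_primitive0 /monomial_density expr0n/= !mul0r !mulr0 subrr.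
rewrite (slice_integral (ltW z0) (@continuous_persp_face z) dF F0) /F.
congr (_%:E); rewrite exp_monomial_primitive_scale// /monomial_density exprMn [z ^+ n.+2]exprS; ring.
Qed.

End Volumes.

(** * An estimate for the tail *)

(** The majorant integrates exactly to [K * (expR L - 1) / L], and dropping the -1 gives the upper
    bound. *)
Lemma naive_tail_bounds (R : realType) n (s u c K L : R) : s != 0 -> 0 < u ->
  0 <= K -> 0 < L ->
  (forall z, 0 <= z <= 1 ->
    expR (z * c) * exp_monomial_primitive s n (z * u) <= K * expR (L * z)) ->
  0 <= naive_tail n s u c <= K * expR L / L.
Proof.
move=> sn0 u0 K0 L0 tailK; have Ln0 : L != 0 by rewrite gt_eqF.
apply/andP; split.
  apply: Rintegral_ge0 => z /=; rewrite in_itv/= => /andP[z0 _].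
  by rewrite mulr_ge0 ?expR_ge0// exp_monomial_primitive_ge0// mulr_ge0// ltW.
have expL : continuous (fun z : R => K * expR (L * z)).
  move=> z; apply: cvgM; first exact: cvg_cst.
  apply: (@continuous_comp _ _ _ (fun z : R => L * z) expR); last exact: continuous_expR.
  by apply: cvgM; [exact: cvg_cst|exact: cvg_id].
have tailC : continuous (fun z : R => expR (z * c) * exp_monomial_primitive s n (z * u)).
  move=> z; apply: cvgM.
    apply: (@continuous_comp _ _ _ (fun z : R => z * c) expR); last exact: continuous_expR.
    by apply: cvgM; [exact: cvg_id|exact: cvg_cst].
  apply: (@continuous_comp _ _ _ (fun z : R => z * u) (exp_monomial_primitive s n));
    last exact: continuous_exp_monomial_primitive.
  by apply: cvgM; [exact: cvg_id|exact: cvg_cst].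
have int (f : R -> R) : continuous f ->
    (@lebesgue_measure R).-integrable `[0%R, 1%R] (EFin \o f).
  move=> cf; apply: continuous_compact_integrable; first exact: segment_compact.
  exact: continuous_subspaceT.
apply: (@le_trans _ _ (\int[@lebesgue_measure R]_(z in `[0%R, 1%R]) (K * expR (L * z)))%R).
  by apply: le_Rintegral => //; exact: int.
have dF (x : R) : is_derive x 1 (K \*: exp_monomial_primitive L 0) (K * expR (L * x)).
  have d0 := is_derive_exp_monomial_primitive Ln0 0 x.
  apply: is_derive_eq; rewrite /monomial_density expr0 fact0 divr1 mulr1.
  by [].
rewrite /Rintegral (integral_itv_antiderivative ler01 expL dF)/=.
rewrite mulr0 mulr1 expR0 subrr mul0r /GRing.scale/= mulr0 subr0 mulrA.
by rewrite ler_pM2r ?invr_gt0// mulrBr lerBlDr lerDl mulr1.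
Qed.

(** * Asymptotics as [u] tends to infinity *)

Section AtInfinity.
Variable R : realType.

Lemma cvg_pinfty_eq (f g : R -> R) (l : R) : (forall u, 0 < u -> f u = g u) ->
  g u @[u --> +oo] --> l -> f u @[u --> +oo] --> l.
Proof.
move=> fg; apply: cvg_trans; apply: near_eq_cvg.
by near=> u; apply/esym/fg; near: u; exact: nbhs_pinfty_gt.
Unshelve. all: by end_near. Qed.

Lemma squeeze_cvg0_pinfty (f g : R -> R) : (forall u, 0 < u -> 0 <= f u <= g u) ->
  g u @[u --> +oo] --> 0 -> f u @[u --> +oo] --> 0.
Proof.
move=> fg; apply: squeeze_cvgr (cvg_cst 0).
by near=> u; apply: fg; near: u; exact: nbhs_pinfty_gt.
Unshelve. all: by end_near. Qed.

Lemma cvg_inv_pinfty : (u : R)^-1 @[u --> +oo] --> 0.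
Proof.
by apply/gtr0_cvgV0; [exact: nbhs_pinfty_gt|exact: cvg_id].
Qed.

Lemma cvg_expr_expRN_pinfty (k : R) m : 0 < k ->
  (u : R) ^+ m * expR (- (k * u)) @[u --> +oo] --> 0.
Proof.
(* [C] is chosen so that [C / u] times the Taylor term of degree [m.+1] of [expR (k * u)] is exactly
   [u ^+ m]. *)
move=> k0; pose C := m.+1`!%:R / k ^+ m.+1.
apply: (@squeeze_cvg0_pinfty _ (fun u => C * u^-1)) => [u u0|]; last first.
  rewrite -[X in _ --> X](mulr0 C); apply: cvgM; first exact: cvg_cst.
  exact: cvg_inv_pinfty.
rewrite mulr_ge0 ?expR_ge0 ?exprn_ge0 ?(ltW u0)//= expRN ler_pdivrMr ?expR_gt0//.
have ku0 : 0 <= k * u by rewrite mulr_ge0 ?ltW.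
have := expR_ge1Dxn m ku0; set e := expR _ => he.
have C0 : 0 <= C / u by rewrite !divr_ge0 ?exprn_ge0 ?ltW.
apply: le_trans (ler_wpM2l C0 he).
rewrite mulrDr mulr1 (_ : C / u * _ = u ^+ m); first by rewrite lerDr.
rewrite /C exprMn [u ^+ m.+1]exprS.
by field; rewrite ?expf_neq0 ?gt_eqF// ltr0n fact_gt0.
Qed.

(** At rate -1 each recursion step subtracts a nonnegative term, starting from [1 - expR (- x)]. *)
Lemma exp_monomial_primitiveN1_le1 m (x : R) : 0 <= x ->
  exp_monomial_primitive (-1) m x <= 1.
Proof.
move=> x0; elim: m => [|m IH] /=.
  by rewrite invrN1 mulrN1 opprB lerBlDr lerDl expR_ge0.
rewrite invrN1 mulrN1 opprB lerBlDr (le_trans IH)// lerDl.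
by rewrite mulr_ge0 ?expR_ge0// monomial_density_ge0.
Qed.

Lemma exp_monomial_primitive1_le m (x : R) : 0 <= x ->
  exp_monomial_primitive 1 m x <= expR x * monomial_density m x.
Proof.
move=> x0; case: m => [|m] /=; rewrite divr1 mul1r.
  by rewrite /monomial_density expr0 fact0 divr1 mulr1 lerBlDr lerDl.
by rewrite lerBlDr lerDl exp_monomial_primitive_ge0.
Qed.

(** The terms subtracted by the recursion are powers times a decaying exponential and vanish in the
    limit. *)
Lemma cvg_exp_monomial_primitiveN1 m :
  exp_monomial_primitive (-1 : R) m u @[u --> +oo] --> (1 : R).
Proof.
elim: m => [|m IH].
  apply: (@cvg_pinfty_eq _ (fun u => 1 - expR (- u))) => [u _|].
    by rewrite /= invrN1 mulrN1 opprB mulN1r.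
  rewrite -[X in _ --> X]subr0; apply: cvgB; first exact: cvg_cst.
  exact: cvgr_expR.
apply: (@cvg_pinfty_eq _ (fun u => exp_monomial_primitive (-1) m u
    - (m.+1`!%:R)^-1 * (u ^+ m.+1 * expR (- (1 * u))))) => [u _|].
  rewrite [LHS]/= invrN1 mulrN1 opprB mulN1r mul1r /monomial_density; ring.
rewrite -[X in _ --> X]subr0; apply: cvgB; first exact: IH.
rewrite -[X in _ --> X](mulr0 (m.+1`!%:R)^-1); apply: cvgM; first exact: cvg_cst.
exact: cvg_expr_expRN_pinfty.
Qed.

(** After normalization the boundary term of the integration by parts is constant, and the remaining
    primitive is smaller by a factor [u^-1]. *)
Lemma cvg_exp_monomial_primitive1 m :
  exp_monomial_primitive (1 : R) m u * expR (- u) / u ^+ m @[u --> +oo] --> ((m`!%:R)^-1 : R).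
Proof.
elim: m => [|m IH].
  apply: (@cvg_pinfty_eq _ (fun u => 1 - expR (- u))) => [u _|].
    by rewrite /= expr0 !divr1 mul1r mulrBl mul1r -expRD subrr expR0.
  rewrite fact0 invr1 -[X in _ --> X]subr0; apply: cvgB; first exact: cvg_cst.
  exact: cvgr_expR.
apply: (@cvg_pinfty_eq _ (fun u => (m.+1`!%:R)^-1
    - exp_monomial_primitive 1 m u * expR (- u) / u ^+ m * u^-1)) => [u u0|].
  rewrite [LHS]/= mul1r divr1 /monomial_density expRN exprS.
  by field; rewrite expf_neq0 ?gt_eqF ?expR_gt0 ?ltr0n ?fact_gt0.
rewrite -[X in _ --> X]subr0; apply: cvgB; first exact: cvg_cst.
rewrite -[X in _ --> X](mulr0 (m`!%:R)^-1); apply: cvgM; first exact: IH.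
exact: cvg_inv_pinfty.
Qed.

End AtInfinity.

(** * The gap in closed form *)

(** Used with [p] the power of [u] in front of the gap and [t] the growth rate of the numerator; the
    denominator grows like [p * t], so [a] and [b] have nonzero limits. *)
Lemma mulr_ratio_scale (F : fieldType) (a b p t : F) : p != 0 -> t != 0 ->
  p * (a * t / (b * (p * t))) = a / b.
Proof. by move=> p0 t0; rewrite invfM; move: b^-1 => b'; field; rewrite p0 t0. Qed.

(** In the difference of the volumes [B] cancels, and the two multiples of [W] leave
    [1/(d+1) - 1/(d+2) = 1/((d+1)(d+2))]. *)
Lemma vol_gap_signed_verts (R : realType) n (s u : R) (v : 'rV[R]_n.+1) c :
  s ^+ 2 = 1 -> 0 < u -> \sum_j v 0 j = c ->
  let W := monomial_density n.+1 u in
  let B := interp_integral n s u c in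
  let N := naive_tail n s u c in
  let A := exp_monomial_primitive s n u in
  vol_gap (signed_verts s v u)
  = (expR c * A / n.+3%:R + W / (n.+2%:R * n.+3%:R) - N)
    / (B / n.+3%:R + W / n.+2%:R - N).
Proof.
move=> s2 u0 <- W B N A.
have gapE (a b a' b' : R) : a = a' -> b = b' -> (a - b) / a = (a' - b') / a' by move=> -> ->.
rewrite /vol_gap (gapE _ _ _ _ (vol_naive_relax v s2 u0) (vol_persp_relax v s2 u0)).
rewrite -/W -/B -/N -/A; congr (_ / _).
by field; rewrite -!natrD !pnatr_eq0.
Qed.

(** * The two limits *)

Section Limits.
Variables (R : realType) (n : nat).

Let fact_neq0 m : (m`!%:R : R) != 0. Proof. by rewrite pnatr_eq0 -lt0n fact_gt0. Qed.
Let natS_neq0 m : (m.+1%:R : R) != 0. Proof. by rewrite pnatr_eq0. Qed.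

Lemma cvg_vol_gap_a (k : R) : 0 < k ->
  (fun u : R => u ^+ n.+1 * vol_gap (@verts_a R n.+1 k u)) @ +oo%R
  --> (n.+2`!%:R : R).
Proof.
(* [kd * u] is the coordinate sum of the vertex [k u 1], so [c] grows with [u] here. *)
move=> k0; set kd := k * n.+1%:R; have kd0 : 0 < kd by rewrite mulr_gt0.
pose N u := naive_tail n (-1) u (kd * u) * expR (- (kd * u)).
pose num u := exp_monomial_primitive (-1) n u
  + (n.+2%:R * n.+1`!%:R)^-1 * (u ^+ n.+1 * expR (- (kd * u))) - n.+3%:R * N u.
pose den u := (n.+1`!%:R)^-1 * (1 - expR (- (kd * u))
    + (expR (- u) - 1) * (n.+1%:R / n.+2%:R) + n.+3%:R / n.+2%:R * expR (- (kd * u)))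
  - n.+3%:R * N u * u^-1 ^+ n.+1.
have N_cvg : N u @[u --> +oo] --> 0.
  apply: (@squeeze_cvg0_pinfty _ _ (fun u => kd^-1 * u^-1)) => [u u0|]; last first.
    rewrite -[X in _ --> X](mulr0 kd^-1); apply: cvgM; first exact: cvg_cst.
    exact: cvg_inv_pinfty.
  have ku0 : 0 < kd * u by rewrite mulr_gt0.
  (* The primitive at rate -1 is at most 1, so [K = 1] and [L = kd * u] are admissible. *)
  have /andP[N0 N1] : 0 <= naive_tail n (-1) u (kd * u) <= 1 * expR (kd * u) / (kd * u).
    apply: naive_tail_bounds => //.
    move=> z /andP[z0 z1]; rewrite mul1r [kd * u * z]mulrC -[leRHS]mulr1.
    apply: ler_wpM2l; first exact: expR_ge0.
    by rewrite exp_monomial_primitiveN1_le1// mulr_ge0// ltW.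
  rewrite /N mulr_ge0 ?expR_ge0//= expRN ler_pdivrMr ?expR_gt0//.
  by rewrite -invfM [leRHS]mulrC -[X in X / _]mul1r.
have E_cvg : expR (- (kd * u)) @[u --> +oo] --> 0.
  apply: cvg_pinfty_eq (cvg_expr_expRN_pinfty 0 kd0) => u _.
  by rewrite expr0 mul1r.
apply: (@cvg_pinfty_eq _ _ (fun u => num u / den u)) => [u u0|].
  rewrite verts_aE (@vol_gap_signed_verts _ _ _ _ _ (kd * u)) ?sqrrN ?expr1n//; last first.
    under eq_bigr do rewrite !mxE mulr1.
    by rewrite sumr_const card_ord -mulr_natr /kd; ring.
  have un0 : u != 0 by rewrite gt_eqF.
  have e0 : expR (kd * u) != 0 by rewrite gt_eqF ?expR_gt0.
  rewrite -(@mulr_ratio_scale _ (num u) (den u) (u ^+ n.+1) (expR (kd * u) / n.+3%:R));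
    [|by rewrite expf_neq0|by rewrite mulf_neq0// invr_eq0 pnatr_eq0].
  rewrite /num /den /N /interp_integral /monomial_density mulN1r expRD !expRN exprVn.
  (* Exponentials, powers and factorials become variables, which leaves a rational identity. *)
  move: (fact_neq0 n.+1) (natS_neq0 n.+1) (natS_neq0 n.+2) (expf_neq0 n.+1 un0) e0.
  move: (expR u)^-1 (expR (kd * u)) (naive_tail _ _ _ _) (exp_monomial_primitive _ _ _).
  move: (u ^+ n.+1) (n.+1`!%:R) (n.+1%:R) (n.+2%:R) (n.+3%:R).
  move=> p f n1 n2 n3 e E T A f0 n20 n30 p0 E0.
  by congr (_ * (_ / _)); field; rewrite ?f0 ?n20 ?n30 ?p0 ?E0.
have num_cvg : num u @[u --> +oo] --> (1 : R).
  rewrite [X in _ --> X](_ : 1 = 1 + (n.+2%:R * n.+1`!%:R)^-1 * 0 - n.+3%:R * 0); last by ring.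
  apply: cvgB; last by apply: cvgM => //; exact: cvg_cst.
  apply: cvgD; first exact: cvg_exp_monomial_primitiveN1.
  by apply: cvgM; [exact: cvg_cst|exact: cvg_expr_expRN_pinfty].
(* The limit is [1/d! * (1 - d/(d+1)) = 1/(d+1)!]. *)
have den_cvg : den u @[u --> +oo] --> ((n.+2`!%:R)^-1 : R).
  rewrite [X in _ --> X](_ : _ = (n.+1`!%:R)^-1 * (1 - 0
    + (0 - 1) * (n.+1%:R / n.+2%:R) + n.+3%:R / n.+2%:R * 0) - n.+3%:R * 0 * 0 ^+ n.+1); last first.
    rewrite [n.+2`!]factS natrM; field.
    by rewrite -?natrD ?nat1r ?pnatr_eq0 -?lt0n ?fact_gt0.
  apply: cvgB; last first.
    apply: cvgM; first by apply: cvgM => //; exact: cvg_cst.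
    apply: (@cvg_comp _ _ _ (fun u : R => u^-1) (fun u : R => u ^+ n.+1)).
      exact: cvg_inv_pinfty.
    exact: exprn_continuous.
  apply: cvgM; first exact: cvg_cst.
  apply: cvgD; last by apply: cvgM => //; exact: cvg_cst.
  apply: cvgD; first by apply: cvgB => //; exact: cvg_cst.
  apply: cvgM; last exact: cvg_cst.
  by apply: cvgB; [exact: cvgr_expR|exact: cvg_cst].
rewrite [X in _ --> X](_ : _ = 1 * ((n.+2`!%:R)^-1)^-1); last by rewrite mul1r invrK.
by apply: cvgM => //; apply: cvgV => //; rewrite invr_eq0 pnatr_eq0 -lt0n fact_gt0.
Qed.

Lemma cvg_vol_gap_b (v : 'rV[R]_n.+1) : (forall j, 0 <= v 0 j) ->
  (fun u : R => u * vol_gap (verts_b v u)) @ +oo%R --> (n.+2%:R : R).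
Proof.
move=> v0; set c := \sum_j v 0 j; have c0 : 0 <= c by apply: sumr_ge0.
pose N u := naive_tail n 1 u c * expR (- c) * expR (- u) / u ^+ n.
pose num u := exp_monomial_primitive 1 n u * expR (- u) / u ^+ n
  + (n.+2%:R * n.+1`!%:R)^-1 * expR (- c) * (u ^+ 1 * expR (- (1 * u))) - n.+3%:R * N u.
pose den u := (n.+1`!%:R)^-1 * (expR (- u) - expR (- c) * expR (- u)
    + (1 - expR (- u)) * (n.+1%:R / n.+2%:R) + n.+3%:R / n.+2%:R * expR (- c) * expR (- u))
  - n.+3%:R * N u * u^-1.
have N_cvg : N u @[u --> +oo] --> 0.
  apply: (@squeeze_cvg0_pinfty _ _ (fun u => (n`!%:R)^-1 * u^-1)) => [u u0|]; last first.
    rewrite -[X in _ --> X](mulr0 (n`!%:R)^-1); apply: cvgM; first exact: cvg_cst.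
    exact: cvg_inv_pinfty.
  have cu0 : 0 < c + u by rewrite ltr_wpDl.
  (* At rate 1 the primitive at [z * u] is at most [expR (z * u)] times the density at [z * u],
     hence at most that exponential times the density at [u]; this gives [K] and [L = c + u]. *)
  have /andP[N0 N1] : 0 <= naive_tail n 1 u c <= monomial_density n u * expR (c + u) / (c + u).
    apply: naive_tail_bounds => //.
      by rewrite monomial_density_ge0// ltW.
    move=> z /andP[z0 z1]; rewrite [(c + u) * z]mulrC mulrDr expRD [leRHS]mulrC -mulrA.
    apply: ler_wpM2l; first exact: expR_ge0.
    have zu0 : 0 <= z * u by rewrite mulr_ge0// ltW.
    apply: le_trans (exp_monomial_primitive1_le n zu0) _.
    apply: ler_wpM2l; first exact: expR_ge0.
    rewrite /monomial_density ler_wpM2r ?invr_ge0// lerXn2r ?nnegrE// ?(ltW u0)//.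
    by rewrite ler_piMl// ltW.
  rewrite /N !mulr_ge0 ?expR_ge0 ?invr_ge0 ?exprn_ge0 ?(ltW u0)//=.
  rewrite ler_pdivrMr ?exprn_gt0// -mulrA -expRD -opprD expRN ler_pdivrMr ?expR_gt0//.
  apply: le_trans N1 _; rewrite [leRHS]mulrAC /monomial_density.
  rewrite [leLHS](_ : _ = u ^+ n / n`!%:R * expR (c + u) * (c + u)^-1)//.
  rewrite [leRHS](_ : _ = u ^+ n / n`!%:R * expR (c + u) * u^-1); last by ring.
  apply: ler_wpM2l; first by rewrite mulr_ge0 ?expR_ge0// divr_ge0// exprn_ge0// ltW.
  by rewrite lef_pV2 ?posrE// lerDr.
apply: (@cvg_pinfty_eq _ _ (fun u => num u / den u)) => [u u0|].
  rewrite verts_bE (@vol_gap_signed_verts _ _ _ _ _ c) ?expr1n//.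
  have un0 : u != 0 by rewrite gt_eqF.
  have e0 : expR u != 0 by rewrite gt_eqF ?expR_gt0.
  have ec0 : expR c != 0 by rewrite gt_eqF ?expR_gt0.
  rewrite -(@mulr_ratio_scale _ (num u) (den u) u (u ^+ n * expR c * expR u / n.+3%:R));
    [|by []|by rewrite !mulf_neq0// ?expf_neq0// invr_eq0 pnatr_eq0].
  rewrite /num /den /N /interp_integral /monomial_density !mul1r expRD !expRN expr1 exprS.
  move: (fact_neq0 n.+1) (natS_neq0 n.+1) (natS_neq0 n.+2) (expf_neq0 n un0) e0 ec0.
  move: (expR u) (expR c) (naive_tail _ _ _ _) (exp_monomial_primitive _ _ _).
  move: (u ^+ n) (n.+1`!%:R) (n.+1%:R) (n.+2%:R) (n.+3%:R).
  move=> p f n1 n2 n3 e E T A f0 n20 n30 p0 e0 E0.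
  by congr (_ * (_ / _)); field; rewrite ?f0 ?n20 ?n30 ?p0 ?E0 ?un0 ?e0.
have e_cvg : expR (- u) @[u --> +oo] --> (0 : R) by exact: cvgr_expR.
have num_cvg : num u @[u --> +oo] --> ((n`!%:R)^-1 : R).
  rewrite [X in _ --> X](_ : _ = (n`!%:R)^-1
    + (n.+2%:R * n.+1`!%:R)^-1 * expR (- c) * 0 - n.+3%:R * 0); last by ring.
  apply: cvgB; last by apply: cvgM => //; exact: cvg_cst.
  apply: cvgD; first exact: cvg_exp_monomial_primitive1.
  by apply: cvgM; [exact: cvg_cst|exact: cvg_expr_expRN_pinfty].
(* The limit is [1/d! * d/(d+1)]; against [1/(d-1)!] in the numerator this yields [d + 1]. *)
have den_cvg : den u @[u --> +oo] --> ((n`!%:R * n.+2%:R)^-1 : R).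
  rewrite [X in _ --> X](_ : _ = (n.+1`!%:R)^-1 * (0 - expR (- c) * 0
    + (1 - 0) * (n.+1%:R / n.+2%:R) + n.+3%:R / n.+2%:R * expR (- c) * 0)
    - n.+3%:R * 0 * 0); last first.
    rewrite [n.+1`!]factS natrM; field.
    by rewrite -?natrD ?nat1r ?pnatr_eq0 -?lt0n ?fact_gt0.
  apply: cvgB; last first.
    apply: cvgM; last exact: cvg_inv_pinfty.
    by apply: cvgM => //; exact: cvg_cst.
  apply: cvgM; first exact: cvg_cst.
  apply: cvgD; last by apply: cvgM => //; exact: cvg_cst.
  apply: cvgD.
    by apply: cvgB => //; apply: cvgM => //; exact: cvg_cst.
  apply: cvgM; last exact: cvg_cst.
  by apply: cvgB => //; exact: cvg_cst.
have fn0 : (n`!%:R : R) != 0 by rewrite pnatr_eq0 -lt0n fact_gt0.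
rewrite [X in _ --> X](_ : _ = (n`!%:R)^-1 * ((n`!%:R * n.+2%:R)^-1)^-1); last first.
  by rewrite invrK mulrA mulVf// mul1r.
by apply: cvgM => //; apply: cvgV => //; rewrite invr_eq0 mulf_neq0// pnatr_eq0.
Qed.

End Limits.

Unset Implicit Arguments.

Theorem theorem14 (R : realType) (d : nat) (hd : (0 < d)%N) :
  (forall k : R, 0 < k ->
     (fun u : R => u ^+ d * vol_gap (@verts_a R d k u)) @ +oo%R
       --> ((d.+1)`!%:R : R)) /\
  (forall v0 : 'rV[R]_d, (forall j, 0 <= v0 0 j) -> v0 != 0 ->
     (fun u : R => u * vol_gap (verts_b v0 u)) @ +oo%R
       --> ((d.+1)%:R : R)).
Proof.
case: d hd => // n _; split=> [k k0|v v0 _]; first exact: cvg_vol_gap_a.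
exact: cvg_vol_gap_b.
Qed.
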